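(* Let $F=\mathbb{F}_q(\!(t)\!)$ with normalized discrete valuation $\mathrm{val}$, absolute value $|x|=q^{-\mathrm{val}(x)}$ and valuation ring $\mathcal{O}_F=\mathbb{F}_q[\![t]\!]$. Let $L\subset F^n$ be a lattice of rank $r$ (with $1\le r\le n$), let $V=\mathrm{span}_F(L)$, let $\mu_V$ be a Haar measure on $V$, and let $\mu_L$ be the probability measure $\mu_L(B)=\mu_V(B\cap L)/\mu_V(L)$. Then for every $v\in\mathbb{Z}^n$, \[\mu_L(L\cap\mathbf{t^v})=q^{-\varphi_L(v)},\qquad\text{where }\varphi_L(v)=\max_{J\subset[n]}(v_J-h_J).\] Equivalently, the pushforward $\nu_L$ of $\mu_L$ under the coordinatewise valuation map satisfies $\nu_L(\{w: w_i\ge v_i\ \forall i\})=q^{-\varphi_L(v)}$ for all $v\in\mathbb{Z}^n$.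
   Context: A lattice $L\subset F^n$ of rank $r$ is the $\mathcal{O}_F$-span of the rows of a full-rank matrix $A\in F^{r\times n}$. Its entropy vector is $h_J=\min_{I\subset[r],|I|=|J|}\mathrm{val}(\det A_{I\times J})$ for $J\subset[n]$, with $h_\varnothing=0$ and $h_J=\infty$ if $|J|>r$. For $v\in\mathbb{R}^n$, $v_J=\sum_{j\in J}v_j$, $v_\varnothing=0$, and terms with $h_J=\infty$ contribute $-\infty$ to the maximum. For $v\in\mathbb{Z}^n$, $\mathbf{t^v}=\{x\in F^n:\mathrm{val}(x_j)\ge v_j\text{ for all }j\}$. The coordinatewise valuation maps $F^n$ to $(\mathbb{Z}\cup\{\infty\})^n$. *)

(* Defs.v *)
From HB Require Import structures.
From mathcomp Require Import all_boot all_order all_algebra zify.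
From mathcomp Require Import all_classical all_reals all_analysis.

Set Implicit Arguments.
Unset Strict Implicit.
Unset Printing Implicit Defensive.

Import Order.TTheory GRing.Theory Num.Theory.

Local Open Scope classical_set_scope.
Local Open Scope ring_scope.

Section LaurentField.
Variable K : finFieldType.
Implicit Types (f g h : int -> K) (a b k m : int).

Definition zero_below m f := forall k, k < m -> f k = 0.

Record laurent : Type := Laurent {
  lcoef :> int -> K ;
  _ : exists m, zero_below m lcoef }.

Lemma lcoef_below (x : laurent) : exists m, zero_below m x.
Proof. by case: x. Qed.

Lemma laurentP (x y : laurent) : (forall k, x k = y k) -> x = y.
Proof.
case: x y => [f fP] [g gP] /= /funext fg; case: _ / fg gP => gP.
by rewrite (Prop_irrelevance fP gP).
Qed.

HB.instance Definition _ := gen_eqMixin laurent.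
HB.instance Definition _ := gen_choiceMixin laurent.

Lemma zero_below_le m a f : a <= m -> zero_below m f -> zero_below a f.
Proof. by move=> am fm k ka; apply: fm; exact: lt_le_trans am. Qed.

Lemma common_below (x y : laurent) :
  exists m, zero_below m x /\ zero_below m y.
Proof.
have [m xm] := lcoef_below x; have [p yp] := lcoef_below y.
exists (Num.min m p); split.
- by apply: zero_below_le xm; rewrite ge_min lexx.
- by apply: zero_below_le yp; rewrite ge_min lexx orbT.
Qed.

Fact lzero_subproof : exists m, zero_below m (fun=> 0 : K).
Proof. by exists 0. Qed.
Definition lzero := Laurent lzero_subproof.

Fact lopp_subproof (x : laurent) : exists m, zero_below m (fun k => - x k).
Proof.
by have [m xm] := lcoef_below x; exists m => k km; rewrite xm ?oppr0.
Qed.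
Definition lopp x := Laurent (lopp_subproof x).

Fact ladd_subproof (x y : laurent) :
  exists m, zero_below m (fun k => x k + y k).
Proof.
have [m [xm ym]] := common_below x y.
by exists m => k km; rewrite xm ?ym ?addr0.
Qed.
Definition ladd x y := Laurent (ladd_subproof x y).

Fact laddA : associative ladd.
Proof. by move=> x y z; apply: laurentP => k /=; rewrite addrA. Qed.
Fact laddC : commutative ladd.
Proof. by move=> x y; apply: laurentP => k /=; rewrite addrC. Qed.
Fact ladd0 : left_id lzero ladd.
Proof. by move=> x; apply: laurentP => k /=; rewrite add0r. Qed.
Fact laddN : left_inverse lzero lopp ladd.
Proof. by move=> x; apply: laurentP => k /=; rewrite addNr. Qed.

HB.instance Definition _ :=
  GRing.isZmodule.Build laurent laddA laddC ladd0 laddN.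

(* For Laurent series the sum is finitely supported. *)
Definition conv f g k : K := \sum_(i \in [set: int]) f i * g (k - i).

Lemma convE a b (N : nat) f g k : zero_below a f -> zero_below b g ->
  k - a - b < N%:Z ->
  conv f g k = \sum_(i < N) f (a + i%:Z) * g (k - a - i%:Z).
Proof.
move=> fa gb kN; rewrite /conv.
rewrite (fsbigE [seq a + i%:Z | i <- iota 0 N]) //=.
- rewrite big_map.
  rewrite (eq_bigl predT) => [|i]; last by rewrite in_setT.
  rewrite -(big_mkord xpredT (fun i => f (a + i%:Z) * g (k - a - i%:Z))).
  rewrite /index_iota subn0; apply: eq_bigr => i _.
  by rewrite opprD addrA.
- by rewrite map_inj_uniq ?iota_uniq // => i j /addrI [].
- move=> i _ iN; case: (ltP i a) => [/fa ->|ai]; first by rewrite mul0r.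
  rewrite [g _]gb ?mulr0 //.
  rewrite ltNge; apply: contra iN => bki; apply/mapP.
  by exists (absz (i - a)%R); rewrite ?mem_iota; lia.
Qed.

Lemma conv_below a b f g : zero_below a f -> zero_below b g ->
  zero_below (a + b) (conv f g).
Proof.
by move=> fa gb k kab; rewrite (@convE a b 0) ?big_ord0 //; lia.
Qed.

Fact lmul_subproof (x y : laurent) : exists m, zero_below m (conv x y).
Proof.
have [m xm] := lcoef_below x; have [p yp] := lcoef_below y.
by exists (m + p); exact: conv_below.
Qed.
Definition lmul x y := Laurent (lmul_subproof x y).

Fact lone_subproof : exists m, zero_below m (fun k => (k == 0)%:R : K).
Proof. by exists 0 => k; case: eqP => // -> ; rewrite ltxx. Qed.
Definition lone := Laurent lone_subproof.

Definition trunc a (N : nat) f : {poly K} := \poly_(i < N) f (a + i%:Z).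

Lemma coef_conv a b (N j : nat) f g : zero_below a f -> zero_below b g ->
  (j < N)%N -> conv f g (a + b + j%:Z) = (trunc a N f * trunc b N g)`_j.
Proof.
move=> fa gb jN; rewrite (@convE a b j.+1) //; last by lia.
rewrite coefM; apply: eq_bigr => -[i /= ij] _.
rewrite !coef_poly !ifT; [|lia|lia].
by congr (_ * g _); lia.
Qed.

Lemma coefM_eq (N j : nat) (p p' q q' : {poly K}) : (j < N)%N ->
  (forall i, (i < N)%N -> p`_i = p'`_i) ->
  (forall i, (i < N)%N -> q`_i = q'`_i) -> (p * q)`_j = (p' * q')`_j.
Proof.
move=> jN pp qq; rewrite !coefM; apply: eq_bigr => -[i /= ij] _.
by rewrite pp ?qq //; lia.
Qed.

Lemma coef_trunc_conv a b (N j : nat) f g :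
  zero_below a f -> zero_below b g -> (j < N)%N ->
  (trunc (a + b) N (conv f g))`_j = (trunc a N f * trunc b N g)`_j.
Proof.
by move=> fa gb jN; rewrite {1}/trunc coef_poly jN (coef_conv fa gb jN).
Qed.

Fact lmulA : associative lmul.
Proof.
move=> x y z; apply: laurentP => k /=.
have [a xa] := lcoef_below x; have [b yb] := lcoef_below y.
have [c zc] := lcoef_below z.
have xya := conv_below xa yb; have yza := conv_below yb zc.
case: (ltP k (a + b + c)) => [kab|abk].
  rewrite (conv_below xa yza) ?(conv_below xya zc) //.
  by rewrite addrA.
have -> : k = a + (b + c) + (absz (k - (a + b + c))%R)%:Z by lia.
set j := absz _.
rewrite (@coef_conv _ _ j.+1 j) //.
rewrite [in RHS]addrA (@coef_conv _ _ j.+1 j) //.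
rewrite (@coefM_eq j.+1 _ _ (trunc a j.+1 x) _
  (trunc b j.+1 y * trunc c j.+1 z)) //; last first.
  by move=> i ij; rewrite coef_trunc_conv.
rewrite mulrA; apply/esym/(@coefM_eq j.+1) => // i ij.
by rewrite coef_trunc_conv.
Qed.

Fact lmulC : commutative lmul.
Proof.
move=> x y; apply: laurentP => k /=.
have [a xa] := lcoef_below x; have [b yb] := lcoef_below y.
case: (ltP k (a + b)) => [kab|abk].
  by rewrite (conv_below xa yb) ?(conv_below yb xa) // addrC.
have -> : k = a + b + (absz (k - (a + b))%R)%:Z by lia.
set j := absz _.
rewrite (@coef_conv _ _ j.+1 j) // [a + b]addrC (@coef_conv _ _ j.+1 j) //.
by rewrite mulrC.
Qed.

Fact lmul1 : left_id lone lmul.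
Proof.
move=> x; apply: laurentP => k /=; rewrite /conv.
rewrite (fsbigE [:: (0 : int)]) //=.
  by rewrite big_cons big_nil in_setT eqxx mul1r subr0 addr0.
by move=> i _; rewrite inE => /negPf ->; rewrite mul0r.
Qed.

Fact lmulDl : left_distributive lmul ladd.
Proof.
move=> x y z; apply: laurentP => k /=.
have [a [xa ya]] := common_below x y; have [b zb] := lcoef_below z.
have xya : zero_below a (ladd x y) by move=> i ia /=; rewrite xa ?ya ?addr0.
have kN : k - a - b < (absz (k - a - b)%R).+1%:Z by lia.
rewrite (convE xya zb kN) (convE xa zb kN) (convE ya zb kN) -big_split /=.
by apply: eq_bigr => i _; rewrite mulrDl.
Qed.

Fact lone_neq0 : lone != 0 :> laurent.
Proof.
apply/eqP => /(congr1 (fun x : laurent => x 0)) /= /eqP.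
by rewrite oner_eq0.
Qed.

HB.instance Definition _ := GRing.Zmodule_isComNzRing.Build laurent
  lmulA lmulC lmul1 lmulDl lone_neq0.

Lemma lcoef_lead (x : laurent) : x != 0 ->
  exists m, x m != 0 /\ zero_below m x.
Proof.
move=> x0; have [a xa] := lcoef_below x.
have ex : exists n : nat, x (a + n%:Z) != 0.
  apply: contrapT => /forallNP xn; move/eqP : x0; apply.
  apply: laurentP => k /=; case: (ltP k a) => [/xa //|ak].
  apply/eqP/negPn/negP => xk; apply: (xn (absz (k - a)%R)).
  by rewrite (_ : a + _ = k) //; lia.
exists (a + (ex_minn ex)%:Z); case: ex_minnP => n xn nmin; split => // k kn.
case: (ltP k a) => [/xa //|ak]; apply/eqP/negPn/negP => xk.
have := nmin (absz (k - a)%R); rewrite (_ : a + _ = k); last by lia.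
by move=> /(_ xk); lia.
Qed.

(* The first [n] coefficients of the inverse of the power series with
   coefficients [u]. *)
Fixpoint inv_seq (u : nat -> K) (n : nat) : seq K :=
  if n is n'.+1 then
    let s := inv_seq u n' in
    rcons s (if n' == 0%N then (u 0%N)^-1 else
             - (u 0%N)^-1 * \sum_(i < n') u (n' - i)%N * s`_i)
  else [::].

Lemma size_inv_seq u n : size (inv_seq u n) = n.
Proof. by elim: n => //= n IH; rewrite size_rcons IH. Qed.

Definition inv_coef u n := (inv_seq u n.+1)`_n.

Lemma nth_inv_seq u n i : (i < n)%N -> (inv_seq u n)`_i = inv_coef u i.
Proof.
elim: n => // n IH; rewrite ltnS leq_eqVlt => /orP[/eqP -> //|ni].
by rewrite -IH //= nth_rcons size_inv_seq ni.
Qed.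

Lemma inv_coefP u n : u 0%N != 0 ->
  \sum_(i < n.+1) inv_coef u i * u (n - i)%N = (n == 0%N)%:R.
Proof.
move=> u0; have rec : inv_coef u n = if n == 0%N then (u 0%N)^-1 else
    - (u 0%N)^-1 * \sum_(i < n) u (n - i)%N * inv_coef u i.
  rewrite {1}/inv_coef /= nth_rcons size_inv_seq ltnn eqxx; case: ifP => // _.
  by congr (_ * _); apply: eq_bigr => i _; rewrite nth_inv_seq.
rewrite big_ord_recr /= subnn rec; case: eqP => [->|_].
  by rewrite big_ord0 add0r mulVf.
rewrite mulrAC mulNr mulVf // mulN1r; apply/eqP; rewrite subr_eq0; apply/eqP.
by apply: eq_bigr => i _; rewrite mulrC.
Qed.

Lemma linv_exists (x : laurent) : x != 0 -> exists y : laurent, y * x = 1.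
Proof.
move=> /lcoef_lead [m [xm x0]].
pose u n := x (m + n%:Z).
pose g k := if k < - m then 0 else inv_coef u (absz (k + m)%R).
have gm : zero_below (- m) g by move=> k km; rewrite /g km.
have gP : exists p, zero_below p g by exists (- m).
exists (Laurent gP); apply: laurentP => k.
rewrite -[LHS]/(conv g x k) -[RHS]/((k == 0)%:R).
case: (ltP k 0) => [k0|k0].
  by rewrite (conv_below gm x0) ?addNr // lt_eqF.
rewrite (@convE (- m) m (absz k).+1 g x) //; last by lia.
transitivity (\sum_(i < (absz k).+1) inv_coef u i * u ((absz k) - i)%N).
  apply: eq_bigr => -[i /= ik] _; rewrite /g ifF; last by lia.
  by congr (inv_coef u _ * x _); lia.
by rewrite inv_coefP ?absz_eq0 // /u addr0.
Qed.

Definition linv (x : laurent) : laurent :=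
  xget 0 [set y | y * x = 1].

Fact lmulV (x : laurent) : x != 0 -> linv x * x = 1.
Proof.
move=> /linv_exists [y yx].
by rewrite /linv; case: xgetP => [z _ //|/(_ y)]; elim.
Qed.

Fact linv0 : linv 0 = 0.
Proof.
rewrite /linv; case: xgetP => // z _ /= /eqP.
by rewrite mulr0 eq_sym oner_eq0.
Qed.

HB.instance Definition _ :=
  GRing.ComNzRing_isField.Build laurent lmulV linv0.

Definition lval (x : laurent) : \bar int :=
  if x == 0 then +oo%E
  else (xget 0 [set m | x m != 0 /\ zero_below m x])%:E.

Lemma lval0 : lval 0 = +oo%E. Proof. by rewrite /lval eqxx. Qed.

Lemma lvalE (x : laurent) m : x m != 0 -> zero_below m x -> lval x = m%:E.
Proof.
move=> xm x0; rewrite /lval ifF; last first.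
  by apply/negP => /eqP xE; move: xm; rewrite xE eqxx.
case: xgetP => [p _ [xp yp]|/(_ m)]; last by elim.
congr (_%:E); apply/eqP; rewrite eq_le !leNgt.
by apply/andP; split; apply/negP => lt;
  [move: xm; rewrite yp ?eqxx|move: xp; rewrite x0 ?eqxx].
Qed.

Lemma lval_ge (x : laurent) m : (m%:E <= lval x)%E <-> zero_below m x.
Proof.
case: (eqVneq x 0) => [->|/lcoef_lead [p [xp x0]]].
  by rewrite lval0 leey.
rewrite (lvalE xp x0) lee_fin; split=> [mp|xm]; first exact: zero_below_le x0.
by rewrite leNgt; apply/negP => /xm xE; rewrite xE eqxx in xp.
Qed.

Definition absv (x : laurent) : rat :=
  if lval x is m%:E then #|K|%:R ^ (- m) else 0.

Lemma absv0 : absv 0 = 0. Proof. by rewrite /absv lval0. Qed.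

Lemma card_gt1 : 1 < #|K|%:R :> rat.
Proof. by rewrite ltr1n; exact: card_finNzRing_gt1. Qed.

Lemma absv_le (x : laurent) m : absv x <= #|K|%:R ^ (- m) <-> zero_below m x.
Proof.
case: (eqVneq x 0) => [->|/lcoef_lead [p [xp x0]]].
  by rewrite absv0 exprz_ge0 ?ler0n.
rewrite -lval_ge /absv (lvalE xp x0) lee_fin.
by rewrite ler_eXz2l ?card_gt1 // lerN2.
Qed.

Lemma absv_ge0 (x : laurent) : 0 <= absv x.
Proof. by rewrite /absv; case: (lval x) => // m; rewrite exprz_ge0 ?ler0n. Qed.

Lemma absv_eq0 (x : laurent) : absv x = 0 -> x = 0.
Proof.
case: (eqVneq x 0) => [//|/lcoef_lead [p [xp x0]]].
rewrite /absv (lvalE xp x0) => /eqP; rewrite expfz_eq0 pnatr_eq0.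
by rewrite -leqn0 leqNgt (ltnW (card_finNzRing_gt1 K)) andbF.
Qed.

Lemma absvN (x : laurent) : absv (- x) = absv x.
Proof.
have le y : absv (- y) <= absv y.
  case: (eqVneq y 0) => [->|/lcoef_lead [p [yp y0]]]; first by rewrite oppr0.
  rewrite {2}/absv (lvalE yp y0); apply/absv_le => k kp.
  by rewrite -[LHS]/(- y k) y0 ?oppr0.
by apply/le_anti; rewrite le -{1}[x]opprK le.
Qed.

Lemma absvD (x y : laurent) : absv (x + y) <= Num.max (absv x) (absv y).
Proof.
wlog yx : x y / absv y <= absv x => [hw|].
  case: (leP (absv y) (absv x)) => [yx|/ltW xy].
    by have := hw x y yx; rewrite max_l.
  by have := hw y x xy; rewrite max_l // addrC.
rewrite max_l //; case: (eqVneq x 0) yx => [->|].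
  by rewrite absv0 add0r.
move=> /lcoef_lead [p [xp x0]].
rewrite [absv x]/absv (lvalE xp x0) => /absv_le yp.
apply/absv_le => k kp.
by rewrite -[LHS]/(x k + y k) x0 ?yp ?addr0.
Qed.

Definition ldist (x y : laurent) : rat := absv (x - y).

Fact ldistxx x : ldist x x = 0.
Proof. by rewrite /ldist subrr absv0. Qed.
Fact ldist_positivity x y : ldist x y = 0 -> x = y.
Proof. by move=> /absv_eq0/eqP; rewrite subr_eq0 => /eqP. Qed.
Fact ldist_sym x y : ldist x y = ldist y x.
Proof. by rewrite /ldist -absvN opprB. Qed.
Fact ldist_triangle y x z : ldist x z <= ldist x y + ldist y z.
Proof.
rewrite /ldist (_ : x - z = (x - y) + (y - z)); last by rewrite addrA subrK.
by apply: le_trans (absvD _ _) _; rewrite ge_max lerDl lerDr !absv_ge0.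
Qed.

HB.instance Definition _ := isMetric.Build rat laurent
  ldistxx ldist_positivity ldist_sym ldist_triangle.

(* This is [K[[t]]]. *)
Definition valring : set laurent := [set x | (0%:E <= lval x)%E].

End LaurentField.

Arguments lval {K}.
Arguments absv {K}.
Arguments valring : clear implicits.

Section Lattice.
Variables (K : finFieldType) (r n : nat).
Implicit Type A : 'M[laurent K]_(r, n).

Definition lattice A : set 'rV[laurent K]_n :=
  [set x | exists c : 'rV[laurent K]_r,
     (forall i, valring K (c ord0 i)) /\ x = c *m A].

(* The determinant of the submatrix with row set [I] and column set [J], both
   in increasing order. Only used when [#|I| = #|J|], where [conform_mx]
   is a mere cast. *)
Definition minor A (I : {set 'I_r}) (J : {set 'I_n}) : laurent K :=
  \det (conform_mx (0 : 'M[laurent K]_#|J|)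
          (mxsub (@enum_val _ (mem I)) (@enum_val _ (mem J)) A)).

(* The index set is [{set0}] for [J = set0] and empty for [#|J| > r], so that
   the conventions [0] and [+oo] for these cases hold (see below). *)
Definition entropy A (J : {set 'I_n}) : \bar int :=
  \big[Order.min/+oo%E]_(I : {set 'I_r} | #|I| == #|J|) lval (minor A I J).

Definition phi A (v : 'I_n -> int) : \bar int :=
  \big[Order.max/-oo%E]_(J : {set 'I_n})
    ((\sum_(j in J) v j)%:E - entropy A J)%E.

Lemma lval_gtNye (x : laurent K) : (-oo < lval x)%E.
Proof. by rewrite /lval; case: eqP => _; rewrite ?ltNyr. Qed.

Lemma lval1 : lval (1 : laurent K) = 0%:E.
Proof.
apply: lvalE; first exact: oner_neq0.
by move=> k k0; rewrite -[LHS]/((k == 0)%:R) lt_eqF.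
Qed.

Lemma entropy0 A : entropy A finset.set0 = 0%:E.
Proof.
rewrite /entropy (big_pred1 finset.set0) => [|I]; last by rewrite cards0 cards_eq0.
rewrite /minor (_ : \det _ = 1) ?lval1 //.
move: (conform_mx _ _); rewrite cards0 => M; exact: det_mx00.
Qed.

Lemma entropy_gt A (J : {set 'I_n}) : (r < #|J|)%N -> entropy A J = +oo%E.
Proof.
move=> rJ; rewrite /entropy big_pred0 // => I; apply/negbTE.
by rewrite neq_ltn (leq_ltn_trans _ rJ) // -[X in (_ <= X)%N]card_ord max_card.
Qed.

(* Hence [fine (phi A v)] is the actual integer [phi A v]. *)
Lemma phi_fin A v : phi A v \is a fin_num.
Proof.
rewrite fin_numElt; apply/andP; split.
  rewrite /phi (bigD1 finset.set0) //= lt_max entropy0 big_set0 sube0 ltNyr //.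
rewrite /phi; elim/big_ind : _ => //= [x y xoo yoo|J _].
  by rewrite gt_max xoo yoo.
have : (-oo < entropy A J)%E.
  rewrite /entropy; elim/big_ind : _ => //= [x y xoo yoo|I _].
    by rewrite lt_min xoo yoo.
  exact: lval_gtNye.
by case: (entropy A J) => //= x _; rewrite -EFinB ltry.
Qed.

End Lattice.

Section Space.
Variables (K : finFieldType) (n : nat).

Definition is_span (L : set 'rV[laurent K]_n) (V : {vspace 'rV[laurent K]_n}) :=
  (forall x, L x -> x \in V) /\
  (forall W : {vspace 'rV[laurent K]_n},
     (forall x, L x -> x \in W) -> (V <= W)%VS).

Definition tpow (v : 'I_n -> int) : set 'rV[laurent K]_n :=
  [set x : 'rV[laurent K]_n | forall j, ((v j)%:E <= lval (x ord0 j))%E].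

Section Haar.
Variable V : {vspace 'rV[laurent K]_n}.

(* [V] with the topology induced by that of [F^n]. *)
HB.instance Definition _ := isPointed.Build (subvs_of V) 0.
HB.instance Definition _ := Topological.copy (subvs_of V)
  (initial_topology (vsval : subvs_of V -> 'rV[laurent K]_n)).

Definition borel : Type := g_sigma_algebraType (@open (subvs_of V)).
HB.instance Definition _ := Measurable.on borel.

(* [V] is locally compact and second countable, so that regularity of [mu]
   is automatic. *)
Record is_haar (R : realType) (mu : {measure set borel -> \bar R}) : Prop := {
  haar_neq0 : mu [set: borel] != 0%E ;
  haar_compact : forall C : set (subvs_of V), compact C -> (mu C < +oo)%E ;
  haar_translation : forall (a : subvs_of V) (B : set borel), measurable B ->
    mu [set a + x | x in (B : set (subvs_of V))] = mu B }.

(* The normalised restriction of [mu] to [L], a Borel measure on [V]. *)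
Definition lattice_measure (R : realType) (mu : {measure set borel -> \bar R})
    (L : set 'rV[laurent K]_n) (B : set borel) : \bar R :=
  (mu (B `&` vsval @^-1` L) / mu (vsval @^-1` L))%E.

End Haar.

(* The discrete countable space of vectors with entries in [int] and [+oo]
   (the value [-oo] is never taken). *)
Definition valvec : Type := 'I_n -> \bar int.

HB.instance Definition _ := Choice.on valvec.
HB.instance Definition _ := isPointed.Build valvec (fun=> 0%:E).
HB.instance Definition _ := @isMeasurable.Build default_measure_display
  valvec discrete_measurable discrete_measurable0
  discrete_measurableC discrete_measurableU.

Definition coordval (V : {vspace 'rV[laurent K]_n}) (x : borel V) : valvec :=
  fun j => lval (vsval x ord0 j).

End Space.

(* Main.v *)
(** Let C be A with its j-th column divided by t^(v_j).  In coordinates with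
    respect to the rows of A, the lattice L becomes O^r and L /\ t^v becomes
    {c in O^r : cC in O^n} = {c : cE in O^(r+n)} for E = [1 | C].  Choose r
    columns of E whose minor D = det E_s has minimal valuation.  By Cramer's
    rule E_s^-1 E is integral, so this set is the lattice O^r E_s^-1.  Up to
    sign the maximal minors of E are the minors of C of all sizes, so that
    val D = - phi(v).

    It remains to see that m (O^r H) = q^(val det G) m (O^r G H) for the
    transported Haar measure m and G integral.  If val det G > 0, then G is
    singular mod t: some u over the residue field with u_i <> 0 satisfies
    uG = 0 mod t.  Replacing row i of G by uG/t lowers val det G by one, and
    the new row lattice is the disjoint union of q translates of the old one.
    The same identity applied to powers of t gives m (O^r) <> 0, and m (O^r)
    is finite because O^r is compact. *)

Require Import Defs.
From mathcomp Require Import all_boot all_order perm all_algebra zify.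
From mathcomp Require Import all_classical all_reals all_analysis.

Set Implicit Arguments.
Unset Strict Implicit.
Unset Printing Implicit Defensive.

Import Order.TTheory GRing.Theory Num.Theory.

Local Open Scope classical_set_scope.
Local Open Scope ring_scope.

(** * Arithmetic of the valuation, monomials [a * t ^ m], and reduction mod [t] *)

Section Valuation.
Variable K : finFieldType.
Local Notation F := (laurent K).
Implicit Types (x y : F) (m p : int).

Lemma lval_lead x : x != 0 ->
  exists m, [/\ lval x = m%:E, x m != 0 & zero_below m x].
Proof. by move=> /lcoef_lead [m [xm x0]]; exists m; rewrite (lvalE xm x0). Qed.

Lemma lval_fin x m : lval x = m%:E -> x != 0.
Proof. by move=> xm; apply/eqP => x0; rewrite x0 lval0 in xm. Qed.

Lemma valringP x : valring K x <-> zero_below 0 x.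
Proof. exact: lval_ge. Qed.

Lemma zero_belowM m p x y : zero_below m x -> zero_below p y ->
  zero_below (m + p) (x * y).
Proof. exact: conv_below. Qed.

Lemma zero_belowD m x y : zero_below m x -> zero_below m y ->
  zero_below m (x + y).
Proof. by move=> xm ym k km; rewrite -[LHS]/(x k + y k) xm ?ym ?addr0. Qed.

Lemma zero_belowN m x : zero_below m x -> zero_below m (- x).
Proof. by move=> xm k km; rewrite -[LHS]/(- x k) xm ?oppr0. Qed.

Lemma zero_below_sum m (I : Type) (s : seq I) (P : pred I) (f : I -> F) :
  (forall i, P i -> zero_below m (f i)) ->
  zero_below m (\sum_(i <- s | P i) f i).
Proof.
by move=> fm; elim/big_ind: _ => // x y; exact: zero_belowD.
Qed.

Lemma coef_lead_mul m p x y : zero_below m x -> zero_below p y ->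
  (x * y) (m + p) = x m * y p.
Proof.
move=> xm yp; rewrite -[LHS]/(Defs.conv x y (m + p)) (@convE _ m p 1) //;
  last by lia.
by rewrite big_ord1 /= addr0 subr0 addrC addKr.
Qed.

(** The lowest coefficients multiply in the field [K], so their product cannot vanish. *)
Lemma lvalM x y : lval (x * y) = (lval x + lval y)%E.
Proof.
have [->|/lval_lead [m [-> xm x0]]] := eqVneq x 0.
  by rewrite mul0r lval0 addye // gt_eqF ?lval_gtNye.
have [->|/lval_lead [p [-> yp y0]]] := eqVneq y 0.
  by rewrite mulr0 lval0 addey.
by rewrite (lvalE (m := m + p)) ?coef_lead_mul ?mulf_neq0 //;
  exact: zero_belowM.
Qed.

Lemma lvalV x m : lval x = m%:E -> lval x^-1 = (- m)%:E.
Proof.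
move=> xm; have x0 := lval_fin xm.
have [p [xp _ _]] := lval_lead (invr_neq0 x0).
have := lvalM x x^-1; rewrite divff // lval1 xm xp => -[] mp.
by rewrite (_ : p = - m) //; lia.
Qed.

Lemma lvalN x : lval (- x) = lval x.
Proof.
have [->|/lval_lead [m [-> xm x0]]] := eqVneq x 0; first by rewrite oppr0.
by apply: lvalE; [rewrite -[X in X != 0]/(- x m) oppr_eq0|exact: zero_belowN].
Qed.

Lemma lval_signM (b : nat) x : lval ((-1) ^+ b * x) = lval x.
Proof. by rewrite -signr_odd mulr_sign; case: ifP => _; rewrite ?lvalN. Qed.

Lemma lval_prod (I : Type) (s : seq I) (P : pred I) (f : I -> F)
    (e : I -> int) :
  (forall i, P i -> lval (f i) = (e i)%:E) ->
  lval (\prod_(i <- s | P i) f i) = (\sum_(i <- s | P i) e i)%:E.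
Proof.
move=> fe; elim/big_ind2 : _ => // [|x m y p xm yp]; first by rewrite lval1.
by rewrite lvalM xm yp EFinD.
Qed.

Lemma lval_div_ge0 x y m : lval y = m%:E -> (m%:E <= lval x)%E ->
  zero_below 0 (x / y).
Proof.
move=> ym /lval_ge xm; rewrite -(subrr m).
by apply: zero_belowM => //; apply/lval_ge; rewrite (lvalV ym).
Qed.

Fact lmono_subproof (a : K) m :
  exists p, zero_below p (fun k => if k == m then a else 0).
Proof. by exists m => k km; rewrite lt_eqF. Qed.

(* [a * t ^ m] *)
Definition lmono a m : F := Laurent (lmono_subproof a m).

Lemma lmono_below a m : zero_below m (lmono a m).
Proof. by move=> k km /=; rewrite lt_eqF. Qed.

Lemma lval_lmono a m : a != 0 -> lval (lmono a m) = m%:E.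
Proof. by move=> a0; apply: lvalE; [rewrite /= eqxx|exact: lmono_below]. Qed.

Lemma lval_lmono1 m : lval (lmono 1 m) = m%:E.
Proof. exact/lval_lmono/oner_neq0. Qed.

Lemma lmono1 : lmono 1 0 = 1.
Proof. by apply: laurentP => k /=; rewrite -[RHS]/((k == 0)%:R); case: eqP. Qed.

Lemma lmono_neq0 m : lmono 1 m != 0.
Proof. exact: lval_fin (lval_lmono1 m). Qed.

Lemma lmonoM (a b : K) m p :
  lmono a m * lmono b p = lmono (a * b) (m + p).
Proof.
apply: laurentP => k; have [->|kmp] := eqVneq k (m + p).
  by rewrite (coef_lead_mul (@lmono_below a m) (@lmono_below b p)) /= !eqxx.
rewrite [RHS]/= (negPf kmp) -[LHS]/(Defs.conv (lmono a m) (lmono b p) k).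
rewrite (@convE _ m p (absz (k - m - p)%R).+1) ?big1 //; last by lia.
- move=> i _ /=; case: eqP => mi; case: eqP => pi;
    by rewrite ?mul0r ?mulr0 //; lia.
- exact: lmono_below.
- exact: lmono_below.
Qed.

Lemma coef0_prod (I : Type) (s : seq I) (P : pred I) (f : I -> F) :
  (forall i, P i -> zero_below 0 (f i)) ->
  zero_below 0 (\prod_(i <- s | P i) f i) /\
  (\prod_(i <- s | P i) f i) 0 = \prod_(i <- s | P i) (f i 0).
Proof.
move=> f0; elim/big_rec2: _ => [|i a y Pi [y0 <-]].
  by split=> // k k0; rewrite -[LHS]/((k == 0)%:R) lt_eqF.
split; first by rewrite -(addr0 0); exact: zero_belowM (f0 _ Pi) y0.
by have := coef_lead_mul (f0 _ Pi) y0; rewrite addr0.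
Qed.

Lemma lcoef_sum (I : Type) (s : seq I) (P : pred I) (f : I -> F) k :
  (\sum_(i <- s | P i) f i) k = \sum_(i <- s | P i) (f i k).
Proof. by elim/big_ind2 : _ => // x a y b <- <-. Qed.

Lemma zero_below_det r (G : 'M[F]_r) :
  (forall i j, zero_below 0 (G i j)) -> zero_below 0 (\det G).
Proof.
move=> G0; apply: zero_below_sum => s _; rewrite mulr_sign.
have [Gs _] := coef0_prod (P := xpredT) (index_enum 'I_r)
  (fun i _ => G0 i (s i)).
by case: ifP => _ //; exact: zero_belowN.
Qed.

(** Reduction mod [t] is multiplicative on integral elements, hence passes through the Leibniz
    formula. *)
Lemma coef0_det r (G : 'M[F]_r) : (forall i j, zero_below 0 (G i j)) ->
  (\det G) 0 = \det (map_mx (fun x : F => x 0) G).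
Proof.
move=> G0; rewrite lcoef_sum; apply: eq_bigr => s _; rewrite !mulr_sign.
have [_ Gs] := coef0_prod (P := xpredT) (index_enum 'I_r)
  (fun i _ => G0 i (s i)).
under [in RHS]eq_bigr do rewrite mxE.
by rewrite -Gs; case: ifP.
Qed.

End Valuation.

(** * Maximal minors of [[1 | C]] versus minors of [C] of all sizes *)

Section AugmentedMinors.
Variable F : fieldType.

(* The columns of the block matrix [1 | C]. *)
Definition aug r n (C : 'M[F]_(r, n)) (x : 'I_r + 'I_n) (i : 'I_r) : F :=
  match x with inl a => (i == a)%:R | inr j => C i j end.

Definition augmx r n (C : 'M[F]_(r, n)) (s : 'I_r -> 'I_r + 'I_n) : 'M[F]_r :=
  \matrix_(i, l) aug C (s l) i.

Lemma det_unit_col r (M : 'M[F]_r.+1) (a l : 'I_r.+1) :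
  (forall i, M i l = (i == a)%:R) ->
  \det M = (-1) ^+ (a + l) * \det (row' a (col' l M)).
Proof.
move=> Ml; rewrite (expand_det_col _ l) (bigD1 a) //= Ml eqxx mul1r.
by rewrite big1 ?addr0 // => i /negPf ia; rewrite Ml ia mul0r.
Qed.

Lemma det_perm_mxsub k (M : 'M[F]_k) (s t : 'S_k) :
  exists b : nat, \det (mxsub s t M) = (-1) ^+ b * \det M.
Proof.
have -> : mxsub s t M = row_perm s (col_perm t M).
  by apply/matrixP => i j; rewrite !mxE.
exists (s + t^-1%g)%N; rewrite row_permE col_permE !det_mulmx !det_perm.
by rewrite mulrCA mulrC exprD.
Qed.

(** Expanding along a chosen unit column deletes that column and one row. Once no unit column is
    left, a minor of [C] remains. *)
Lemma det_augmx_minor r n (C : 'M[F]_(r, n)) (s : 'I_r -> 'I_r + 'I_n) :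
  \det (augmx C s) = 0 \/
  exists k (f : 'I_k -> 'I_r) (g : 'I_k -> 'I_n) (b : nat),
    \det (augmx C s) = (-1) ^+ b * \det (mxsub f g C).
Proof.
elim: r => [|r IH] in C s *.
  right; exists 0, id, (fun i : 'I_0 => match s i with inr j => j
    | inl a => match (notF (ltn_ord a)) with end end), 0%N.
  by rewrite !det_mx00 mulr1.
have [[l [a sl]]|nol] := pselect (exists l a, s l = inl a); last first.
  right; have /choice [g gE] : forall l, exists j, s l = inr j.
    move=> l; case sl : (s l) => [a|j]; last by exists j.
    by exfalso; apply: nol; exists l, a.
  exists r.+1, id, g, 0%N; rewrite mul1r; congr (\det _).
  by apply/matrixP => i j; rewrite !mxE gE.
(* If the same unit column is chosen twice, the determinant has two equal columns. *)
have [[l' [l'l sl']]|nol] := pselect (exists l', l' != l /\ s l' = inl a).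
  left; rewrite -det_tr; apply: (determinant_alternate l'l) => i.
  by rewrite !mxE sl sl'.
(* No other chosen column is the unit vector at [a], so deleting row [a] leaves columns of
   [[1 | row' a C]]. *)
have /choice [s' s'E] : forall m, exists x : 'I_r + 'I_n, forall i,
    aug (row' a C) x i = aug C (s (lift l m)) (lift a i).
  move=> m; case sm : (s (lift l m)) => [b|j]; last first.
    by exists (inr j) => i /=; rewrite !mxE.
  case: (unliftP a b) => [b' ba|ba].
    by exists (inl b') => i /=; rewrite ba (inj_eq lift_inj).
  exfalso; apply: nol; exists (lift l m); split; last by rewrite sm ba.
  by rewrite eq_sym neq_lift.
have -> : \det (augmx C s) = (-1) ^+ (a + l) * \det (augmx (row' a C) s').
  rewrite (@det_unit_col _ _ a l) => [|i]; last by rewrite mxE sl.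
  by congr (_ * \det _); apply/matrixP => i m; rewrite !mxE s'E.
have [->|[k [f [g [b ->]]]]] := IH (row' a C) s'; first by left; rewrite mulr0.
right; exists k, (lift a \o f), g, (a + l + b)%N.
rewrite mulrA -exprD; congr (_ * \det _).
by apply/matrixP => i j; rewrite !mxE.
Qed.

(** The columns of the minor are completed by the unit columns at the rows outside the image of
    [f]. *)
Lemma minor_det_augmx r n (C : 'M[F]_(r, n)) k
    (f : 'I_k -> 'I_r) (g : 'I_k -> 'I_n) : injective f ->
  exists (s : 'I_r -> 'I_r + 'I_n) (b : nat),
    \det (augmx C s) = (-1) ^+ b * \det (mxsub f g C).
Proof.
elim: r => [|r IH] in C f * => finj.
  have k0 : k = 0%N by have := leq_card _ finj; rewrite !card_ord leqn0 => /eqP.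
  case: _ / (esym k0) f g finj => f g _.
  by exists (fun a => inl a), 0%N; rewrite !det_mx00 mulr1.
have [[a fa]|nof] := pselect (exists a, forall i, f i != a).
  have /choice [f' f'E] : forall i, exists x, f i = lift a x.
    move=> i; case: (unliftP a (f i)) => [x fx|fx]; first by exists x.
    by move: (fa i); rewrite fx eqxx.
  have f'inj : injective f'.
    by move=> i j ij; apply: finj; rewrite !f'E ij.
  have [s' [b s'E]] := IH (row' a C) f' f'inj.
  pose s l := if unlift ord0 l is Some l' then
      match s' l' with inl c => inl (lift a c) | inr j => inr j end
    else inl a.
  exists s, (a + b)%N; rewrite (@det_unit_col _ _ a ord0); last first.
    by move=> i; rewrite mxE /s unlift_none.
  rewrite [in RHS]exprD -mulrA /= addn0; congr (_ * _).
  transitivity (\det (augmx (row' a C) s')).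
    congr (\det _); apply/matrixP => i l; rewrite !mxE /s liftK.
    by case: (s' l) => [c|j] /=; rewrite ?(inj_eq lift_inj) // mxE.
  rewrite s'E; congr (_ * \det _).
  by apply/matrixP => i j; rewrite !mxE f'E.
have fsurj a : exists i, f i = a.
  apply: contrapT => noi; apply: nof; exists a => i; apply/eqP => fia.
  by apply: noi; exists i.
have kr : k = r.+1.
  apply/eqP; rewrite eqn_leq.
  have := leq_card _ finj; rewrite !card_ord => -> /=.
  have /choice [h hE] := fsurj.
  have hinj : injective h by move=> x y xy; rewrite -(hE x) xy hE.
  by have := leq_card _ hinj; rewrite !card_ord.
case: _ / (esym kr) f g finj {IH nof fsurj} => f g finj.
pose p := perm finj.
exists (fun l => inr (g (p^-1%g l))).
have [b bE] := det_perm_mxsub (mxsub f g C) p^-1%g p^-1%g.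
exists b; rewrite -bE; congr (\det _); apply/matrixP => i l; rewrite !mxE /=.
by rewrite -[in RHS](permE finj) permKV.
Qed.

Lemma det_mxsub_inj r n (C : 'M[F]_(r, n)) k
    (f : 'I_k -> 'I_r) (g : 'I_k -> 'I_n) :
  \det (mxsub f g C) != 0 -> injective f /\ injective g.
Proof.
move=> D0; split=> i j ij; apply/eqP; apply: contraNT D0 => neij; apply/eqP.
  by apply: (determinant_alternate neij) => l; rewrite !mxE ij.
by rewrite -det_tr; apply: (determinant_alternate neij) => l; rewrite !mxE ij.
Qed.

(** Enumerating the same row and column sets in another order permutes rows and columns, which
    affects only the sign. This frees [minor] from its increasing enumerations. *)
Lemma det_conform_mxsub r n (C : 'M[F]_(r, n)) p q k
    (h1 : 'I_p -> 'I_r) (h2 : 'I_q -> 'I_n)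
    (f : 'I_k -> 'I_r) (g : 'I_k -> 'I_n) :
  p = k -> q = k -> injective f -> injective g ->
  (forall i, exists x, h1 x = f i) -> (forall i, exists x, h2 x = g i) ->
  exists b : nat, \det (conform_mx (0 : 'M[F]_q) (mxsub h1 h2 C))
    = (-1) ^+ b * \det (mxsub f g C).
Proof.
move=> pk qk finj ginj.
case: _ / (esym pk) h1 => h1; case: _ / (esym qk) h2 => h2.
move=> /choice [s sE] /choice [t tE].
have sinj : injective s by move=> i j ij; apply: finj; rewrite -!sE ij.
have tinj : injective t by move=> i j ij; apply: ginj; rewrite -!tE ij.
rewrite conform_mx_id.
have [b bE] := det_perm_mxsub (mxsub f g C) (perm sinj)^-1%g (perm tinj)^-1%g.
exists b; rewrite -bE; congr (\det _); apply/matrixP => i l; rewrite !mxE /=.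
by rewrite -sE -tE -(permE sinj) -(permE tinj) !permKV.
Qed.

(* Cramer's rule *)
Lemma mul_adj_augmx r n (C : 'M[F]_(r, n)) (s : 'I_r -> 'I_r + 'I_n) x i :
  \sum_l (\adj (augmx C s)) i l * aug C x l =
  \det (augmx C (fun l => if l == i then x else s l)).
Proof.
rewrite (expand_det_col _ i); apply: eq_bigr => l _.
rewrite !mxE eqxx mulrC; congr (_ * _); rewrite /cofactor; congr (_ * \det _).
by apply/matrixP => a b; rewrite !mxE eq_sym (negPf (neq_lift _ _)).
Qed.

End AugmentedMinors.

(** * The function [phi] as minus the least valuation of an augmented minor *)

Section Entropy.
Variables (K : finFieldType) (r n : nat).
Implicit Types (A C : 'M[laurent K]_(r, n)) (v : 'I_n -> int).

(** Dividing column [j] by [t ^ v j] turns the condition [tpow v (c *m A)] into integrality of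
    [c *m scaled A v]. *)
Definition scaled A v : 'M[laurent K]_(r, n) :=
  \matrix_(i, j) (A i j * lmono 1 (- v j)).

Lemma lval_minor_imset A k (f : 'I_k -> 'I_r) (g : 'I_k -> 'I_n) :
  injective f -> injective g ->
  lval (minor A ([set f i | i : 'I_k]%SET) ([set g i | i : 'I_k]%SET)) =
  lval (\det (mxsub f g A)).
Proof.
move=> finj ginj; rewrite /minor.
have im (T : finType) (h : 'I_k -> T) : injective h ->
    #|[set h i | i : 'I_k]%SET| = k.
  by move=> hinj; rewrite card_imset // card_ord.
have surj (T : finType) (h : 'I_k -> T) i :
    exists x : 'I_#|[set h i | i : 'I_k]%SET|, enum_val x = h i.
  have hi : h i \in [set h i | i : 'I_k]%SET by rewrite imset_f.
  by exists (enum_rank_in hi (h i)); rewrite enum_rankK_in.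
have [b ->] := det_conform_mxsub A (im _ _ finj) (im _ _ ginj) finj ginj
  (surj _ f) (surj _ g).
by rewrite lval_signM.
Qed.

Lemma lval_minor_enum A (I : {set 'I_r}) (J : {set 'I_n}) : #|I| = #|J| ->
  exists (f : 'I_#|J| -> 'I_r) (g : 'I_#|J| -> 'I_n),
    [/\ injective f, lval (minor A I J) = lval (\det (mxsub f g A))
      & forall v, \sum_l v (g l) = \sum_(j in J) v j].
Proof.
move=> IJ.
pose f (l : 'I_#|J|) : 'I_r := enum_val (cast_ord (esym IJ) l).
pose g (l : 'I_#|J|) : 'I_n := enum_val l.
have ginj : injective g by exact: enum_val_inj.
have finj : injective f by move=> i j /enum_val_inj /cast_ord_inj.
exists f, g; split=> //; last by move=> v; rewrite [RHS]big_enum_val.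
rewrite -lval_minor_imset //; congr (lval (minor _ _ _)); apply/setP => x.
  apply/idP/imsetP => [xI|[l _ ->]]; last exact: enum_valP.
  exists (cast_ord IJ (enum_rank_in xI x)) => //.
  by rewrite /f cast_ordK enum_rankK_in.
apply/idP/imsetP => [xJ|[l _ ->]]; last exact: enum_valP.
by exists (enum_rank_in xJ x); rewrite // /g enum_rankK_in.
Qed.

Lemma lval_det_scaled A v k (f : 'I_k -> 'I_r) (g : 'I_k -> 'I_n) :
  lval (\det (mxsub f g (scaled A v))) =
  (lval (\det (mxsub f g A)) - (\sum_l v (g l))%:E)%E.
Proof.
have -> : mxsub f g (scaled A v) =
    mxsub f g A *m diag_mx (\row_l lmono 1 (- v (g l))).
  by apply/matrixP => i j; rewrite mul_mx_diag !mxE.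
rewrite det_mulmx det_diag lvalM (@lval_prod _ _ _ _ _ (fun l => - v (g l))).
  by rewrite sumrN EFinN.
by move=> l _; rewrite mxE lval_lmono1.
Qed.

(** Scaling lowers the valuation of a minor with column set [J] by [v_J]. Every minor of [A] occurs
    in this way among the augmented ones, giving [v_J + m <= h_J]; the minimal augmented minor is
    itself such a minor, and its [J] gives the reverse bound. *)
Lemma phi_augmx A v (s : 'I_r -> 'I_r + 'I_n) m :
  lval (\det (augmx (scaled A v) s)) = m%:E ->
  (forall s', (m%:E <= lval (\det (augmx (scaled A v) s')))%E) ->
  phi A v = (- m)%:E.
Proof.
move=> sm smin; apply/le_anti/andP; split.
  apply: bigmax_le => [|J _]; first exact: leNye.
  set vJ := \sum_(j in J) v j.
  suff le : ((vJ + m)%:E <= entropy A J)%E.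
    have -> : (- m)%:E = (vJ%:E - (vJ + m)%:E)%E :> \bar int.
      by rewrite -EFinB; congr EFin; lia.
    exact: leeB.
  apply: le_bigmin => [|I /eqP IJ]; first exact: leey.
  have [f [g [finj -> gv]]] := lval_minor_enum A IJ.
  have [s' [b s'E]] := minor_det_augmx (scaled A v) g finj.
  have := smin s'; rewrite s'E lval_signM lval_det_scaled gv -/vJ.
  by rewrite leeBrDr // -EFinD addrC.
have D0 := lval_fin sm.
have [DE|[k [f [g [b DE]]]]] := det_augmx_minor (scaled A v) s.
  by rewrite DE eqxx in D0.
move: sm; rewrite DE lval_signM => sm.
have [finj ginj] := det_mxsub_inj (lval_fin sm).
set J := [set g i | i : 'I_k]%SET.
apply: le_trans (le_bigmax _ _ J); set vJ := \sum_(j in J) v j.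
have hJ : (entropy A J <= (vJ + m)%:E)%E.
  apply: (@le_trans _ _ (lval (minor A [set f i | i : 'I_k]%SET J))).
    by apply: bigmin_le_cond; rewrite !card_imset.
  rewrite lval_minor_imset //; move: sm; rewrite lval_det_scaled.
  have -> : \sum_l v (g l) = vJ by rewrite /vJ big_imset //= => i j _ _ /ginj.
  case: (lval _) => [x| |] //; rewrite -EFinB => -[xm].
  by rewrite lee_fin; lia.
have -> : (- m)%:E = (vJ%:E - (vJ + m)%:E)%E :> \bar int.
  by rewrite -EFinB; congr EFin; lia.
exact: leeB.
Qed.
End Entropy.

(** * Integral matrices and the lattices they generate *)

Section Integral.
Variable K : finFieldType.
Local Notation F := (laurent K).
Implicit Type N : int.

Definition zero_below_mx N m n (M : 'M[F]_(m, n)) :=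
  forall i j, zero_below N (M i j).

Lemma zero_below_mulmx N1 N2 m n p (M1 : 'M[F]_(m, n)) (M2 : 'M[F]_(n, p)) :
  zero_below_mx N1 M1 -> zero_below_mx N2 M2 ->
  zero_below_mx (N1 + N2) (M1 *m M2).
Proof.
move=> M1N M2N i j; rewrite mxE; apply: zero_below_sum => k _.
exact: zero_belowM.
Qed.

Lemma zero_below_mx_exists m n (M : 'M[F]_(m, n)) :
  exists N, zero_below_mx N M.
Proof.
have /choice [f fE] : forall ij : 'I_m * 'I_n, exists N,
  zero_below N (M ij.1 ij.2) by move=> ij; exact: lcoef_below.
(* Minus the sum of the absolute values lies below each entrywise bound. *)
exists (- \sum_ij `|f ij|) => i j; apply: zero_below_le (fE (i, j)).
rewrite lerNl (bigD1 (i, j)) //=; set s := \sum_(_ | _) _.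
have : 0 <= s by apply: sumr_ge0.
lia.
Qed.

Lemma latticeE r n (G : 'M[F]_(r, n)) y :
  lattice G y <-> exists2 x : 'rV_r, zero_below_mx 0 x & y = x *m G.
Proof.
split=> [[x [x0 ->]]|[x x0 ->]].
  by exists x => // i j; rewrite ord1; apply/valringP.
by exists x; split=> // i; apply/valringP.
Qed.

Lemma lattice1 r (y : 'rV[F]_r) : lattice 1%:M y <-> zero_below_mx 0 y.
Proof.
rewrite latticeE; split=> [[x x0 ->]|y0]; first by rewrite mulmx1.
by exists y; rewrite ?mulmx1.
Qed.

Lemma zero_below_adj r (G : 'M[F]_r) :
  zero_below_mx 0 G -> zero_below_mx 0 (\adj G).
Proof.
move=> G0 i j; rewrite mxE /cofactor.
have D0 : zero_below 0 (\det (row' j (col' i G))).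
  by apply: zero_below_det => a b; rewrite !mxE.
by apply/lval_ge; rewrite lval_signM; apply/lval_ge.
Qed.

Lemma zero_below_invmx r (G : 'M[F]_r) :
  zero_below_mx 0 G -> lval (\det G) = 0%:E -> zero_below_mx 0 (invmx G).
Proof.
move=> G0 D0 i j; rewrite /invmx unitmxE unitfE (lval_fin D0) mxE mulrC.
apply: lval_div_ge0 D0 _; apply/lval_ge; exact: zero_below_adj.
Qed.

Lemma lval_ge_scaled (x : F) (m : int) :
  (m%:E <= lval x)%E <-> zero_below 0 (x * lmono 1 (- m)).
Proof.
rewrite -lval_ge lvalM lval_lmono1; case: (lval x) => [y| |] /=.
- by rewrite -EFinD !lee_fin subr_ge0.
- by rewrite !leey.
- by rewrite !leeNy_eq.
Qed.

(** The witness is [invmx E], where [E] consists of [r] columns of [[1 | scaled A v]] with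
    determinant of minimal valuation. *)
Lemma sublattice_tpow r n (A : 'M[F]_(r, n)) (v : 'I_n -> int) :
  exists (G : 'M[F]_r), [/\ zero_below_mx 0 G, lval (\det G) = phi A v &
    forall c : 'rV_r,
      lattice G c <-> zero_below_mx 0 c /\ tpow v (c *m A)].
Proof.
set C := scaled A v.
pose D (s : {ffun 'I_r -> 'I_r + 'I_n}) := lval (\det (augmx C s)).
case: (@arg_minP _ _ _ [ffun i => inl i] xpredT D isT) => s _ smin.
have smin' s' : (D s <= lval (\det (augmx C s')))%E.
  have := smin (finfun s') isT; rewrite {2}/D.
  by have -> : augmx C (finfun s') = augmx C s'
    by apply/matrixP => i j; rewrite !mxE ffunE.
(* The choice [inl] of all unit columns has determinant 1, so the minimum is at most 0 and hence
   finite. *)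
have [m sm] : exists m, D s = m%:E.
  have : (D s <= 0%:E)%E.
    have <- : lval (\det (augmx C inl)) = 0%:E.
      by have -> : augmx C inl = 1%:M;
        [apply/matrixP => i j; rewrite !mxE|rewrite det1 lval1].
    exact: smin'.
  have := lval_gtNye (\det (augmx C s)); rewrite -/(D s).
  by case: (D s) => // m _ _; exists m.
rewrite sm in smin'.
set E := augmx C s in sm *.
have Eu : E \in unitmx by rewrite unitmxE unitfE (lval_fin sm).
(* By Cramer's rule this entry is a quotient of two augmented minors whose denominator has minimal
   valuation. *)
have U x i : zero_below 0 (\sum_l invmx E i l * aug C x l).
  have -> : \sum_l invmx E i l * aug C x l =
      \det (augmx C (fun l => if l == i then x else s l)) / \det E.
    rewrite -mul_adj_augmx mulr_suml; apply: eq_bigr => l _.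
    by rewrite /invmx Eu mxE -mulrA mulrC.

  exact: lval_div_ge0 sm (smin' _).
have G0 : zero_below_mx 0 (invmx E).
  move=> i j; rewrite (_ : invmx E i j =
    \sum_l invmx E i l * aug C (inl j) l) //.
  rewrite (bigD1 j) //= eqxx mulr1 big1 ?addr0 // => l /negPf lj.
  by rewrite lj mulr0.
have tE (c : 'rV[F]_r) : tpow v (c *m A) <-> zero_below_mx 0 (c *m C).
  have cC j : (c *m C) ord0 j = (c *m A) ord0 j * lmono 1 (- v j).
    rewrite !mxE mulr_suml; apply: eq_bigr => i _.
    by rewrite !mxE mulrA.
  split=> [cv i j|cC0 j]; first by rewrite ord1 cC; exact/lval_ge_scaled.
  by apply/lval_ge_scaled; rewrite -cC.
exists (invmx E); split=> //.
  by rewrite det_inv (lvalV sm) (phi_augmx sm).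
move=> c; rewrite tE latticeE; split=> [[x x0 ->]|[c0 cC0]].
  split; first by rewrite -(addr0 0); exact: zero_below_mulmx.
  rewrite -mulmxA -(addr0 0); apply: zero_below_mulmx => // i j.
  by rewrite mxE; exact: (U (inr j)).
(* Each column of [E] comes from [1] or from [C], so the entries of [c *m E] are entries of [c] or
   of [c *m C]. *)
exists (c *m E); last by rewrite mulmxK.
move=> i j; case sj : (s j) => [a|k].
  rewrite (_ : _ i j = c i a) // mxE (bigD1 a) //= mxE sj /= eqxx mulr1.
  by rewrite big1 ?addr0 // => l /negPf la; rewrite mxE sj /= la mulr0.
rewrite (_ : _ i j = (c *m C) i k) // !mxE.
by apply: eq_bigr => l _; rewrite !mxE sj /= mxE.
Qed.

(* [u / t]; [refine_mx u i] is the identity with row [i] replaced by it, and if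
   [u_i != 0] its row lattice contains [O^r] with index [q]. *)
Definition refine_row r (u : 'rV[K]_r) : 'rV[F]_r :=
  \row_l lmono (u ord0 l) (-1).

Definition refine_mx r (u : 'rV[K]_r) (i : 'I_r) : 'M[F]_r :=
  \matrix_(k, l) (if k == i then refine_row u ord0 l else (k == l)%:R).

Lemma det_refine_mx r (u : 'rV[K]_r) (i : 'I_r) :
  \det (refine_mx u i) = lmono (u ord0 i) (-1).
Proof.
pose C : 'M[F]_(r, 1) := (refine_row u)^T.
(* Cramer's rule for the identity matrix: its column [i] is replaced by the transpose of
   [refine_row u]. *)
have := mul_adj_augmx C inl (inr ord0) i.
have -> : augmx C inl = 1%:M by apply/matrixP => a b; rewrite !mxE.
rewrite adj1 (bigD1 i) //= !mxE eqxx mul1r big1 => [|l li]; last first.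
  by rewrite !mxE eq_sym (negPf li) mul0r.
rewrite addr0 => ->; rewrite -det_tr; congr (\det _); apply/matrixP => a b.
by rewrite !mxE; case: eqP => _ /=; rewrite ?mxE // eq_sym.
Qed.

Lemma mul_refine_mx r (u : 'rV[K]_r) (i : 'I_r) (y : 'rV[F]_r) l :
  (y *m refine_mx u i) ord0 l =
  y ord0 i * refine_row u ord0 l + (if l == i then 0 else y ord0 l).
Proof.
rewrite mxE (bigD1 i) //= mxE eqxx; congr (_ + _).
case: eqP => [->|/eqP li].
  by rewrite big1 // => k ki; rewrite mxE (negPf ki) mulr0.
rewrite (bigD1 l) //= mxE (negPf li) eqxx mulr1 big1 ?addr0 // => k.
by case/andP => ki kl; rewrite mxE (negPf ki) (negPf kl) mulr0.
Qed.

(** In a multiple of [u / t] by an integral scalar, only the constant coefficient of the scalar can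
    produce a pole. This coefficient indexes the cosets of [O^r]. *)
Lemma lattice_refine_mx r (u : 'rV[K]_r) (i : 'I_r) (y : 'rV[F]_r) :
  u ord0 i != 0 ->
  lattice (refine_mx u i) y <->
  exists (a : K) (z : 'rV[F]_r), zero_below_mx 0 z /\
    y = lmono a 0 *: refine_row u + z.
Proof.
move=> ui; set w := refine_row u.
have wl l : zero_below (-1) (w ord0 l) by rewrite mxE; exact: lmono_below.
have wi : lval (w ord0 i) = (-1)%:E by rewrite mxE lval_lmono.
rewrite latticeE; split=> [[x x0 ->]|[a [z [z0 ->]]]].
  exists (x ord0 i 0).
  exists (\row_l ((x ord0 i - lmono (x ord0 i 0) 0) * w ord0 l
           + (if l == i then 0 else x ord0 l))).
  split; last first.
    apply/rowP => l; rewrite mul_refine_mx !mxE addrA mulrBl.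
    by rewrite addrCA addrN addr0.
  move=> k l; rewrite mxE; apply: zero_belowD; last by case: ifP.
  rewrite -(addrN 1); apply: zero_belowM => // p p1 /=.
  rewrite -[LHS]/(x ord0 i p - (if p == 0 then x ord0 i 0 else 0)).
  case: eqP => [->|p0]; first by rewrite subrr.
  by rewrite subr0 x0 //; lia.
(* Since [w_i] has valuation exactly -1, [b] is divisible by [t]. Adding [b] to the scalar absorbs
   [z_i] and changes the other coordinates only by integral amounts. *)
set b := z ord0 i / w ord0 i.
have b1 : zero_below 1 b.
  rewrite -[1]add0r; apply: zero_belowM => //.
  by apply/lval_ge; rewrite (lvalV wi).
exists (\row_l (if l == i then lmono a 0 + b else z ord0 l - b * w ord0 l)).
  move=> k l; rewrite mxE; case: eqP => _.
    apply: zero_belowD; first exact: lmono_below.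
    exact: zero_below_le b1.
  apply: zero_belowD => //; apply: zero_belowN.
  by rewrite -(addrN 1); exact: zero_belowM.
apply/rowP => l; rewrite mul_refine_mx !mxE eqxx -/w mulrDl.
rewrite -addrA; congr (_ + _).
case: eqP => [->|_].
  have wiE : w ord0 i = lmono (u ord0 i) (-1) by rewrite mxE.
  by rewrite addr0 /b -wiE mulfVK // (lval_fin wi).
by rewrite addrC subrK.
Qed.

(** The coefficient of [t ^ (-1)] in coordinate [i] is [a * u_i], which determines [a]; hence the
    cosets are disjoint. *)
Lemma refine_row_inj r (u : 'rV[K]_r) (i : 'I_r) (a b : K) (z z' : 'rV[F]_r) :
  u ord0 i != 0 -> zero_below_mx 0 z -> zero_below_mx 0 z' ->
  lmono a 0 *: refine_row u + z = lmono b 0 *: refine_row u + z' -> a = b.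
Proof.
move=> ui z0 z'0 /rowP /(_ i) /(congr1 (fun x : F => x (-1))).
rewrite !mxE.
rewrite -[LHS]/((lmono a 0 * lmono (u ord0 i) (-1)) (-1) + z ord0 i (-1)).
rewrite -[RHS]/((lmono b 0 * lmono (u ord0 i) (-1)) (-1) + z' ord0 i (-1)).
rewrite z0 // z'0 // !addr0.
have cE c : (lmono c 0 * lmono (u ord0 i) (-1)) (-1) = c * u ord0 i.
  have := coef_lead_mul (@lmono_below _ c 0) (@lmono_below _ (u ord0 i) (-1)).
  by rewrite add0r => ->; rewrite /= ?eqxx.
by rewrite !cE => /(mulIf ui).
Qed.

(** Positive valuation makes [G] singular mod [t]. A left kernel vector [u] over [K] gives [u *m G]
    divisible by [t], so row [i] can be replaced by an integral row. *)
Lemma refine_exists r (G : 'M[F]_r) (d : nat) :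
  zero_below_mx 0 G -> lval (\det G) = (d.+1%:Z)%:E ->
  exists (u : 'rV[K]_r) (i : 'I_r), [/\ u ord0 i != 0,
    zero_below_mx 0 (refine_mx u i *m G) &
    lval (\det (refine_mx u i *m G)) = (d%:Z)%:E].
Proof.
move=> G0 Gd.
have : \det (map_mx (fun x : F => x 0) G) == 0.
  rewrite -coef0_det //.
  have /lval_ge -> // : (d.+1%:Z%:E <= lval (\det G))%E by rewrite Gd.
case/det0P => u u0 uG.
have [i ui] : exists i, u ord0 i != 0 by apply/rV0Pn.
exists u, i; split=> //; last first.
  rewrite det_mulmx lvalM Gd det_refine_mx lval_lmono // -EFinD.
  by congr EFin; lia.
have ul l : zero_below 1 ((map_mx (fun a => lmono a 0) u *m G) ord0 l).
  have z0 : zero_below 0 ((map_mx (fun a => lmono a 0) u *m G) ord0 l).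
    rewrite -(addr0 0); apply: zero_below_mulmx => // a b.
    by rewrite mxE; exact: lmono_below.
  move=> k k1; have [->|k0] := eqVneq k 0; last by rewrite z0 //; lia.
  move/rowP: uG => /(_ l); rewrite [RHS]mxE => uGl.
  rewrite mxE lcoef_sum -[RHS]uGl mxE.
  apply: eq_bigr => j _; rewrite !mxE.
  have := coef_lead_mul (@lmono_below _ (u ord0 j) 0) (G0 j l).
  by rewrite addr0 => ->; rewrite /= ?eqxx.
move=> k l; rewrite mxE; have [->|ki] := eqVneq k i; last first.
  rewrite (_ : \sum_j _ = G k l) //.
  rewrite (bigD1 k) //= mxE (negPf ki) eqxx mul1r big1 ?addr0 // => j jk.
  by rewrite mxE (negPf ki) eq_sym (negPf jk) mul0r.
rewrite (_ : \sum_j _ = lmono 1 (-1) *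
  (map_mx (fun a => lmono a 0) u *m G) ord0 l).
  rewrite -(addNr 1); apply: zero_belowM => //; exact: lmono_below.
rewrite mxE mulr_sumr; apply: eq_bigr => j _; rewrite !mxE eqxx mulrA.
by rewrite lmonoM mul1r addr0.
Qed.

End Integral.

(** * Scaling of a coset-invariant measure under passage to a sublattice *)

Section Index.
Variables (R : realType) (K : finFieldType) (r : nat).
Local Notation F := (laurent K).
Variables (d : measure_display) (T : measurableType d).
Variables (mu : {measure set T -> \bar R}) (kap : T -> 'rV[F]_r).
Hypothesis meas_coset : forall (c : 'rV[F]_r) (G : 'M[F]_r), G \in unitmx ->
  measurable (kap @^-1` [set c + x | x in lattice G]).
Hypothesis mu_coset : forall (c : 'rV[F]_r) (G : 'M[F]_r), G \in unitmx ->
  mu (kap @^-1` [set c + x | x in lattice G]) = mu (kap @^-1` lattice G).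

(** The larger lattice is the disjoint union, over [a] in [K], of the translates of the smaller one
    by [a * w]. *)
Lemma mu_refine (u : 'rV[K]_r) (i : 'I_r) (H : 'M[F]_r) :
  u ord0 i != 0 -> H \in unitmx ->
  mu (kap @^-1` lattice (refine_mx u i *m H)) =
  (#|K|%:R%:E * mu (kap @^-1` lattice H))%E.
Proof.
move=> ui Hu; pose w := refine_row u *m H.
pose S (a : K) := kap @^-1` [set lmono a 0 *: w + x | x in lattice H].
have -> : kap @^-1` lattice (refine_mx u i *m H) = \bigcup_(a in [set: K]) S a.
  rewrite predeqE => x; split.
    rewrite /preimage /= latticeE => -[y y0 xE].
    have : lattice (refine_mx u i) (y *m refine_mx u i).
      by apply/latticeE; exists y.
    rewrite lattice_refine_mx // => -[a [z [z0 yE]]].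
    exists a => //; exists (z *m H); first by apply/latticeE; exists z.
    by rewrite xE mulmxA yE mulmxDl scalemxAl.
  move=> [a _ [_ /latticeE [z z0 ->] xE]].
  have : lattice (refine_mx u i) (lmono a 0 *: refine_row u + z).
    by apply/lattice_refine_mx => //; exists a, z.
  move=> /latticeE [y y0 yE]; apply/latticeE; exists y => //.
  by rewrite -xE mulmxA -yE mulmxDl scalemxAl.
rewrite measure_fin_bigcup; first last.
- by move=> a _; exact: meas_coset.
- move=> a b _ _ [x [[_ /latticeE [z z0 ->] xa] [_ /latticeE [z' z'0 ->] xb]]].
  have : (lmono a 0 *: refine_row u + z) *m H =
         (lmono b 0 *: refine_row u + z') *m H.
    by rewrite !mulmxDl -!scalemxAl xa xb.
  by move=> /(can_inj (mulmxK Hu)) /(refine_row_inj ui z0 z'0).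
- exact: finite_finset.
rewrite (fsbigE (enum K)) ?enum_uniq //= => [|a _]; last by rewrite mem_enum.
rewrite (eq_bigr (fun=> mu (kap @^-1` lattice H))) => [|a _];
  last exact: mu_coset.
rewrite (eq_bigl predT) => [|a]; last by rewrite in_setT.
rewrite cardE; elim: (enum K) => [|a s IH]; first by rewrite big_nil mul0e.
by rewrite big_cons IH -{1}[mu _]mul1e -ge0_muleDl // -EFinD nat1r.
Qed.

(** Induction on [e]: for [e = 0] the inverse of [G] is integral and the two lattices coincide;
    otherwise one refinement lowers [e] by one and contributes one factor [q]. *)
Lemma mu_lattice_mul (e : nat) (G H : 'M[F]_r) :
  zero_below_mx 0 G -> lval (\det G) = (e%:Z)%:E -> H \in unitmx ->
  mu (kap @^-1` lattice H) =
  ((#|K|%:R ^+ e)%:E * mu (kap @^-1` lattice (G *m H)))%E.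
Proof.
elim: e G => [|e IH] G G0 Ge Hu.
  rewrite mul1e; congr (mu _); rewrite predeqE => x /=; rewrite !latticeE.
  have Gi := zero_below_invmx G0 Ge.
  split=> [[y y0 ->]|[y y0 ->]].
    exists (y *m invmx G); first by rewrite -(addr0 0); exact: zero_below_mulmx.
    by rewrite !mulmxA mulmxKV // unitmxE unitfE (lval_fin Ge).
  exists (y *m G); first by rewrite -(addr0 0); exact: zero_below_mulmx.
  by rewrite mulmxA.
have [u [i [ui P0 Pe]]] := refine_exists G0 Ge.
rewrite (IH _ P0 Pe Hu) -mulmxA mu_refine //.
  by rewrite muleA -EFinM exprSr.
by rewrite unitmx_mul Hu unitmxE unitfE (lval_fin Ge).
Qed.

End Index.

(** * Neighbourhoods in [F^n] and in [V] *)

Section Topology.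
Variables (K : finFieldType) (n : nat).
Local Notation F := (laurent K).
Implicit Types (x y : 'rV[F]_n).

Lemma small_absv (e : rat) : 0 < e ->
  exists N : int, forall z : F, zero_below N z -> absv z < e.
Proof.
have q0 : 0 < #|K|%:R :> rat := lt_trans ltr01 (card_gt1 K).
move=> e0; have e1 : 0 <= e^-1 by rewrite invr_ge0 ltW.
(* This exponent works because [q ^ N > N > e^-1]. *)
exists (Num.bound e^-1)%:Z => z /absv_le /le_lt_trans; apply.
rewrite -exprnN -invf_plt ?posrE ?exprn_gt0 //.
apply: lt_trans (archi_boundP e1) _.
by rewrite -natrX ltr_nat ltn_expl // card_finNzRing_gt1.
Qed.

Lemma nbhs_zero_below x (W : set 'rV[F]_n) :
  nbhs x W <-> exists N : int, forall y, zero_below_mx N (y - x) -> W y.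
Proof.
split=> [/nbhs_ballP [e /= e0 eW]|[N NW]].
  have [N Ne] := small_absv e0; exists N => y yx; apply: eW; split=> // i j.
  rewrite -metricType_numDomainType.ball_mdistE /=.
  by apply: Ne; have /zero_belowN := yx i j; rewrite !mxE opprB.
apply/nbhs_ballP; exists (#|K|%:R ^ (- N)).
  by rewrite /= exprz_gt0 // (lt_trans ltr01 (card_gt1 K)).
move=> y [_ xy]; apply: NW => i j.
have := xy i j; rewrite -metricType_numDomainType.ball_mdistE /= => /ltW.
by rewrite /mdist /= => /absv_le /zero_belowN; rewrite !mxE opprB.
Qed.

Variable V : {vspace 'rV[F]_n}.

Lemma nbhs_subvs (x : subvs_of V) (W : set (subvs_of V)) :
  nbhs x W <->
  exists N : int, forall y : subvs_of V,
    zero_below_mx N (vsval y - vsval x) -> W y.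
Proof.
split=> [[_ [[B Bop <-] Bx BW]]|[N NW]].
  have /nbhs_zero_below [N NB] : nbhs (vsval x) B by exact: open_nbhs_nbhs.
  by exists N => y yx; apply: BW; exact: NB.
have : nbhs (vsval x) [set y : 'rV[F]_n | zero_below_mx N (y - vsval x)].
  by apply/nbhs_zero_below; exists N.
move=> /(@initial_continuous _ _ (vsval : subvs_of V -> 'rV[F]_n) x) xN.
by apply: (filterS _ (xN : nbhs x _)) => y; exact: NW.
Qed.

Lemma open_subvs (W : set (subvs_of V)) (N : int) :
  (forall x y : subvs_of V, W x -> zero_below_mx N (vsval y - vsval x) ->
    W y) -> open W.
Proof.
move=> WN; rewrite openE => x Wx; apply/nbhs_subvs; exists N => y.
exact: WN.
Qed.

End Topology.

(** * Coordinates on [V] and the Haar measure of lattices *)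

Section Coordinates.
Variables (K : finFieldType) (r n : nat) (A : 'M[laurent K]_(r, n)).
Hypothesis A_full : \rank A = r.
Variable V : {vspace 'rV[laurent K]_n}.
Hypothesis V_span : is_span (lattice A) V.
Local Notation F := (laurent K).

(** By full row rank [pinvmx A] is a right inverse of [A], so on [V], the row space of [A], this
    gives the coefficients with respect to the rows of [A]. *)
Definition coords (x : borel V) : 'rV[F]_r := vsval x *m pinvmx A.

Lemma mul_pinvmx : A *m pinvmx A = 1%:M.
Proof. by apply: mulmxVp; rewrite /row_free A_full. Qed.

Lemma span_rowspace (y : 'rV[F]_n) : y \in V <-> exists c, y = c *m A.
Proof.
have [LV minV] := V_span; split=> [yV|[c ->]].
  have VW : (V <= limg (linfun (mulmxr A : 'rV[F]_r -> 'rV[F]_n)))%VS.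
    apply: minV => _ [c [_ ->]]; have -> : c *m A = linfun (mulmxr A) c.
      by rewrite lfunE.
    by rewrite memv_img ?memvf.
  have /memv_imgP [c _ ->] := subvP VW _ yV.
  by exists c; rewrite lfunE.
rewrite mulmx_sum_row; apply: memv_suml => i _; apply: memvZ; apply: LV.
apply/latticeE; exists (delta_mx 0 i); last by rewrite rowE.
move=> a b k k0; rewrite mxE ord1 eqxx /=; case: eqP => //= _.
by rewrite -[LHS]/((k == 0)%:R) lt_eqF.
Qed.

Lemma coordsK (x : borel V) : coords x *m A = vsval x.
Proof.
have /span_rowspace [c xc] := subvsP x.
by rewrite /coords xc -(mulmxA c) mul_pinvmx mulmx1.
Qed.

Lemma coords_surj (c : 'rV[F]_r) : exists x, coords x = c.
Proof.
have cV : c *m A \in V by apply/span_rowspace; exists c.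
by exists (Subvs cV); rewrite /coords /= -mulmxA mul_pinvmx mulmx1.
Qed.

Lemma lattice_coords (x : borel V) :
  lattice A (vsval x) <-> zero_below_mx 0 (coords x).
Proof.
rewrite latticeE; split=> [[c c0 xc]|x0]; last first.
  by exists (coords x); rewrite ?coordsK.
by rewrite /coords xc -mulmxA mul_pinvmx mulmx1.
Qed.

(** Such a coset is open: the poles of [pinvmx A *m invmx G] are bounded, so small displacements in
    [V] are elements of [lattice G] in coordinates. *)
Lemma measurable_coset (c : 'rV[F]_r) (G : 'M[F]_r) : G \in unitmx ->
  measurable (coords @^-1` [set c + x | x in lattice G]).
Proof.
move=> Gu; apply: sub_sigma_algebra.
have [N NB] := zero_below_mx_exists (pinvmx A *m invmx G).
apply: (@open_subvs _ _ _ _ (- N)) => x y [_ /latticeE [z z0 ->] xz] yx.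
exists ((z + (vsval y - vsval x) *m (pinvmx A *m invmx G)) *m G).
  apply/latticeE; eexists; last by [].
  move=> i j; rewrite mxE; apply: zero_belowD => //.
  by rewrite -(addNr N); exact: zero_below_mulmx.
rewrite mulmxDl addrA xz mulmxA mulmxKV // mulmxBl /coords.
by rewrite addrC subrK.
Qed.

Lemma measurable_lattice (G : 'M[F]_r) : G \in unitmx ->
  measurable (coords @^-1` lattice G).
Proof.
move=> Gu; have := measurable_coset 0 Gu.
rewrite (_ : [set _ | _ in _] = lattice G) // predeqE => x; split.
  by move=> [y yG <-]; rewrite add0r.
by move=> xG; exists x => //; rewrite add0r.
Qed.

(** An ultrafilter on the lattice selects a value for each coefficient of each coordinate; the
    selected values form its limit. *)
Lemma compact_lattice : compact (coords @^-1` lattice 1%:M : set (subvs_of V)).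
Proof.
rewrite compact_ultra => U UU UL.
(* If [U] contained no value class, it would contain all their complements, and, [K] being finite,
   the empty intersection of these. *)
have pick (ik : 'I_r * int) : exists a : K,
    U [set x | coords x ord0 ik.1 ik.2 = a].
  apply: contrapT => noa.
  have H a : U [set x | coords x ord0 ik.1 ik.2 <> a].
    have [|//] := in_ultra_setVsetC [set x | coords x ord0 ik.1 ik.2 = a] UU.
    by move=> Ua; exfalso; apply: noa; exists a.
  have [x /(_ _)] := filter_ex (filter_forall _ H).
  by move=> /(_ (coords x ord0 ik.1 ik.2)); apply.
have [a aP] := choice pick.
have a0 i : zero_below 0 (fun k => a (i, k)).
  move=> k k0; have [x [/= <-]] := filter_ex (filterI (aP (i, k)) UL).
  by move=> /lattice1 x0; exact: x0.
pose c : 'rV[F]_r := \row_i Laurent (ex_intro _ 0 (a0 i)).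
have [x0 x0c] := coords_surj c.
have c0 : zero_below_mx 0 c by move=> i j; rewrite mxE; exact: a0.
exists x0; split; first by rewrite /preimage /= x0c; apply/lattice1.
move=> W /nbhs_subvs [N NW].
have [NA AN] := zero_below_mx_exists A.
(* Multiplication by [A] shifts orders by at least [NA], so agreement of the coordinates below
   [N - NA] suffices. Coefficients of negative index vanish, leaving finitely many conditions. *)
have near : U [set x | forall ik : 'I_r * 'I_(absz (N - NA)%R),
    coords x ord0 ik.1 ik.2%:Z = a (ik.1, ik.2%:Z)].
  by apply: filter_forall => -[i k]; exact: aP (i, k%:Z).
apply: filterS (filterI near UL) => x [xa /lattice1 xL]; apply: NW.
rewrite -!coordsK -mulmxBl -(subrK NA N); apply: zero_below_mulmx => //.
move=> i j k kN.
have -> : (coords x - coords x0) i j =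
    coords x ord0 j - Laurent (ex_intro _ 0 (a0 j)).
  by rewrite x0c ord1 [LHS]mxE [X in _ + X]mxE [c _ _]mxE.
rewrite -[LHS]/(coords x ord0 j k - a (j, k)).
have [k0|k0] := ltP k 0; first by rewrite a0 // xL // subrr.
have kN' : (absz k < absz (N - NA)%R)%N by lia.
have := xa (j, Ordinal kN'); rewrite /= (_ : (absz k)%:Z = k); last by lia.
by move=> ->; rewrite subrr.
Qed.

Variables (R : realType) (mu : {measure set (borel V) -> \bar R}).
Hypothesis mu_haar : is_haar mu.

Lemma haar_coset (c : 'rV[F]_r) (G : 'M[F]_r) : G \in unitmx ->
  mu (coords @^-1` [set c + x | x in lattice G]) = mu (coords @^-1` lattice G).
Proof.
move=> Gu; have [a ac] := coords_surj c.
rewrite -(haar_translation mu_haar a (measurable_lattice Gu)).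
congr (mu _); rewrite predeqE => x; split=> [[y yG xy]|[y yG <-]].
  exists (x - a : subvs_of V); last by rewrite addrC subrK.
  rewrite /preimage /= /coords linearB /= mulmxBl.
  by rewrite -!/(coords _) ac -xy addrC addKr.
by exists (coords y) => //; rewrite -ac /coords linearD /= mulmxDl.
Qed.

Lemma haar_lattice_fin : mu (coords @^-1` lattice 1%:M) \is a fin_num.
Proof.
rewrite ge0_fin_numE; last exact: measure_ge0.
exact: (@haar_compact _ _ _ _ _ mu_haar _ compact_lattice).
Qed.

Lemma haar_lattice_mul (e : nat) (G H : 'M[F]_r) :
  zero_below_mx 0 G -> lval (\det G) = (e%:Z)%:E -> H \in unitmx ->
  mu (coords @^-1` lattice H) =
  ((#|K|%:R ^+ e)%:E * mu (coords @^-1` lattice (G *m H)))%E.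
Proof. exact: mu_lattice_mul measurable_coset haar_coset e G H. Qed.

(** If [O^r] were null, so would be every [t ^ (-k) O^r] by the index formula, and these countably
    many lattices exhaust [V]. *)
Lemma haar_lattice_neq0 : mu (coords @^-1` lattice 1%:M) != 0%E.
Proof.
apply/eqP => mu0; have /eqP := haar_neq0 mu_haar; apply.
pose S k := coords @^-1` lattice ((lmono 1 (- k%:Z))%:M : 'M[F]_r).
have Su (k : int) : (lmono 1 k)%:M \in @unitmx F r.
  by rewrite unitmxE det_scalar unitfE expf_neq0 // lmono_neq0.
have S0 k : mu (S k) = 0%E.
  (* The exponent is [k * r] because the scalar matrix [t ^ k] has determinant [t ^ (k * r)]. *)
  rewrite /S (@haar_lattice_mul (k * r) (lmono 1 k%:Z)%:M) //.
  - by rewrite -scalar_mxM lmonoM mul1r addrN lmono1 mu0 mule0.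
  - move=> i j; rewrite mxE; case: eqP => // _.
    by apply: zero_below_le (@lmono_below _ 1 k%:Z); lia.
  - rewrite det_scalar -{1}(card_ord r) -prodr_const.
    rewrite (@lval_prod _ _ _ _ _ (fun=> k%:Z)).
      by rewrite sumr_const card_ord -mulr_natr natz.
    by move=> i _; rewrite lval_lmono1.
have -> : [set: borel V] = \bigcup_k S k.
  rewrite predeqE => x; split=> // _.
  have [N xN] := zero_below_mx_exists (coords x).
  exists (absz N) => //; apply/latticeE.
  exists (coords x *m (lmono 1 (absz N)%:Z)%:M); last first.
    by rewrite -mulmxA -scalar_mxM lmonoM mul1r addrN lmono1 mulmx1.
  rewrite mul_mx_scalar => i j; rewrite mxE.
  apply: (@zero_below_le _ ((absz N)%:Z + N)); first by lia.
  by apply: zero_belowM => //; exact: lmono_below.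
apply: measure_negligible.
  by apply: bigcupT_measurable => k; exact: measurable_lattice.
apply: negligible_bigcup => k; exists (S k); split=> //.
exact: measurable_lattice.
Qed.

End Coordinates.

Theorem theorem2p1 (R : realType) (K : finFieldType) (r n : nat)
    (r_ge1 : (1 <= r)%N) (r_le_n : (r <= n)%N)
    (A : 'M[laurent K]_(r, n)) (A_full : \rank A = r)
    (V : {vspace 'rV[laurent K]_n}) (V_span : is_span (lattice A) V)
    (mu : {measure set (borel V) -> \bar R}) (mu_haar : is_haar mu)
    (v : 'I_n -> int) :
  lattice_measure mu (lattice A) (vsval @^-1` (lattice A `&` tpow v))
    = (#|K|%:R ^ (- fine (phi A v)))%:E
  /\
  pushforward (lattice_measure mu (lattice A)) (@coordval K n V)
      [set w : valvec n | forall i, ((v i)%:E <= w i)%E]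
    = (#|K|%:R ^ (- fine (phi A v)))%:E.
Proof.
(* The pushforward statement measures the same set, since [lattice_measure] already intersects with
   the lattice. *)
suff index : lattice_measure mu (lattice A) (vsval @^-1` (lattice A `&` tpow v))
    = (#|K|%:R ^ (- fine (phi A v)))%:E.
  split=> //; rewrite -index /pushforward /lattice_measure; congr (mu _ / _)%E.
  rewrite predeqE => x; split=> [[xv xL]|[[_ xv] xL]]; by split.
have [G [G0 Gphi Giff]] := sublattice_tpow A v.
have phi_fin := phi_fin A v.
(* [phi A v] is the valuation of the determinant of the integral matrix [G], hence nonnegative. *)
have [e eE] : exists e : nat, phi A v = (e%:Z)%:E.
  have /lval_ge : zero_below 0 (\det G) by exact: zero_below_det.
  rewrite Gphi; case: (phi A v) phi_fin => // m _; rewrite lee_fin => m0.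
  by exists (absz m); congr EFin; lia.
rewrite eE in Gphi *.
rewrite /lattice_measure.
have -> : vsval @^-1` lattice A = coords A (V := V) @^-1` lattice 1%:M.
  rewrite predeqE => x; rewrite /preimage /= lattice1.
  exact: lattice_coords.
have -> : vsval @^-1` (lattice A `&` tpow v) `&`
      (coords A (V := V) @^-1` lattice 1%:M)
    = coords A (V := V) @^-1` lattice G.
  rewrite predeqE => x; rewrite /preimage /= lattice1 Giff.
  rewrite -lattice_coords // coordsK //.
  by split=> [[[? ?] ?]|[? ?]]; split.
have := haar_lattice_mul A_full V_span mu_haar G0 Gphi (unitmx1 _ _).
have := haar_lattice_neq0 A_full V_span mu_haar.
have := haar_lattice_fin A_full V_span mu_haar.
rewrite mulmx1 => Lfin L0 LG.
have q0 : (#|K|%:R ^+ e : R) != 0.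
  by rewrite expf_neq0 // pnatr_eq0 -lt0n (ltn_trans _ (card_finNzRing_gt1 K)).
move: Lfin L0; rewrite LG.
(* An infinite value times [q ^ e > 0] would make the measure of [O^r] infinite. *)
case: (mu (coords A (V := V) @^-1` lattice G)) => [m| |].
- rewrite -EFinM eqe => _ L0; rewrite inver (negPf L0) -EFinM; congr EFin.
  move: L0; rewrite mulf_eq0 negb_or => /andP[_ m0].
  by rewrite invfM mulrCA divff // mulr1 -exprnN.
- by rewrite gt0_muley // lte_fin lt_def q0 exprn_ge0.
- by rewrite gt0_muleNy // lte_fin lt_def q0 exprn_ge0.
Qed.
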